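(* Let $B$ be a Boolean $\sigma$-algebra. Then $B$ is a measure algebra if and only if $B$ is weakly distributive and uniformly concentrated.
   Context: A Boolean algebra $B$ is an algebra of subsets of a given nonempty set $S$, with Boolean operations $a\cup b$, $a\cap b$, $-a=S-a$, zero $\mathbf 0=\emptyset$ and unit $\mathbf 1=S$ (so $\mathbf 0\neq\mathbf 1$), ordered by inclusion. A Boolean $\sigma$-algebra is a Boolean algebra $B$ in which every countable subset $A\subset B$ has a supremum $\bigvee A$ and an infimum $\bigwedge A$ in the partial ordering of $B$ (suprema and infima are computed in $B$; they need not be set-theoretic unions and intersections). $B^+=B-\{\mathbf 0\}$. An antichain is a set $A\subset B^+$ with $a\cap b=\mathbf 0$ for all distinct $a,b\in A$. A maximal antichain $W$ is one with $\bigvee W=\mathbf 1$. For a finite set $E\subset B$, $\bigcup E$ denotes the join of its elements. For a sequence $\{a_n\}_n$ in a Boolean $\sigma$-algebra, $\limsup_n a_n=\bigwedge_{n=1}^\infty\bigvee_{k=n}^\infty a_k$ and $\liminf_n a_n=\bigvee_{n=1}^\infty\bigwedge_{k=n}^\infty a_k$; if both equal $a$, then $a$ is the limit of the sequence, written $\lim_n a_n=a$. A measure on a Boolean $\sigma$-algebra $B$ is a real-valued function $m$ on $B$ such that (i) $m(\mathbf 0)=0$, $m(a)>0$ for $a\neq\mathbf 0$, and $m(\mathbf 1)=1$; (ii) $m(a)\le m(b)$ if $a\subset b$; (iii) $m(a\cup b)=m(a)+m(b)$ if $a\cap b=\mathbf 0$; (iv) $m(\bigvee_{n=1}^\infty a_n)=\sum_{n=1}^\infty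 m(a_n)$ whenever the $a_n$ are pairwise disjoint. A measure algebra is a Boolean $\sigma$-algebra that carries a measure. $B$ is weakly distributive if whenever $\{W_n\}_n$ is a sequence of countable maximal antichains, each $W_n$ has a finite subset $E_n$ such that $\lim_n\bigcup E_n=\mathbf 1$. $B$ is uniformly concentrated if there exists a function $F$ such that for each finite (nonempty) antichain $A$, $F(A)$ is an element of $A$, and whenever $\{A_n\}_n$ is a sequence of finite antichains with $|A_n|\ge 2^n$ for every $n$, then $\lim_n F(A_n)=\mathbf 0$. *)

(* Defs.v *)
From mathcomp Require Import all_boot all_order all_algebra.
From mathcomp Require Import all_classical all_reals all_analysis.

Set Implicit Arguments.
Unset Strict Implicit.
Unset Printing Implicit Defensive.

Import Order.TTheory GRing.Theory Num.Theory.
Import numFieldNormedType.Exports.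

Local Open Scope classical_set_scope.
Local Open Scope ring_scope.

(* A Boolean algebra is a field of sets [B] on [S].  Suprema and infima of
   infinite families are taken in the poset [B]; they are relations because
   they need not be the set-theoretic unions and intersections. *)
Definition boolean_algebra (S : Type) (B : set (set S)) : Prop :=
  [/\ B set0, B setT, setU_closed B, setI_closed B & setC_closed B].

Definition is_sup (S : Type) (B A : set (set S)) (s : set S) : Prop :=
  [/\ B s,
      forall a, A a -> a `<=` s &
      forall t, B t -> (forall a, A a -> a `<=` t) -> s `<=` t].

Definition is_inf (S : Type) (B A : set (set S)) (s : set S) : Prop :=
  [/\ B s,
      forall a, A a -> s `<=` a &
      forall t, B t -> (forall a, A a -> t `<=` a) -> t `<=` s].

Definition boolean_sigma_algebra (S : Type) (B : set (set S)) : Prop :=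
  boolean_algebra B /\
  forall A : set (set S), A `<=` B -> countable A ->
    (exists s, is_sup B A s) /\ (exists s, is_inf B A s).

Definition antichain (S : Type) (B A : set (set S)) : Prop :=
  [/\ A `<=` B, ~ A set0 &
      forall a b, A a -> A b -> a <> b -> a `&` b = set0].

Definition maximal_antichain (S : Type) (B W : set (set S)) : Prop :=
  antichain B W /\ is_sup B W setT.

Definition is_limsup (S : Type) (B : set (set S)) (a : nat -> set S)
    (l : set S) : Prop :=
  exists s : nat -> set S,
    (forall n, is_sup B [set a k | k in [set k | (n <= k)%N]] (s n)) /\
    is_inf B (range s) l.

Definition is_liminf (S : Type) (B : set (set S)) (a : nat -> set S)
    (l : set S) : Prop :=
  exists s : nat -> set S,
    (forall n, is_inf B [set a k | k in [set k | (n <= k)%N]] (s n)) /\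
    is_sup B (range s) l.

Definition is_lim (S : Type) (B : set (set S)) (a : nat -> set S)
    (l : set S) : Prop :=
  is_limsup B a l /\ is_liminf B a l.

(* Only the values of [m] on [B] matter. *)
Record is_measure (R : realType) (S : Type) (B : set (set S))
    (m : set S -> R) : Prop := IsMeasure {
  measure_zero : m set0 = 0;
  measure_pos : forall a, B a -> a <> set0 -> 0 < m a;
  measure_one : m setT = 1;
  measure_mono : forall a b, B a -> B b -> a `<=` b -> m a <= m b;
  measure_add : forall a b, B a -> B b -> a `&` b = set0 ->
    m (a `|` b) = m a + m b;
  measure_sigma_add : forall (a : nat -> set S) (s : set S),
    (forall n, B (a n)) -> (forall i j, i <> j -> a i `&` a j = set0) ->
    is_sup B (range a) s ->
    series (fun n => m (a n)) @ \oo --> m s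
}.

Definition measure_algebra (R : realType) (S : Type) (B : set (set S)) : Prop :=
  boolean_sigma_algebra B /\ exists m : set S -> R, is_measure B m.

Definition weakly_distributive (S : Type) (B : set (set S)) : Prop :=
  forall W : nat -> set (set S),
    (forall n, countable (W n) /\ maximal_antichain B (W n)) ->
    exists E : nat -> set (set S),
      (forall n, finite_set (E n) /\ E n `<=` W n) /\
      is_lim B (fun n => \bigcup_(e in E n) e) setT.

(* Sequences are numbered from 1 in the source, so [A n] stands for the
   antichain of index [n.+1]; hence the bound [2 ^ n.+1]. *)
Definition uniformly_concentrated (S : Type) (B : set (set S)) : Prop :=
  exists F : set (set S) -> set S,
    (forall A, antichain B A -> finite_set A -> A !=set0 -> A (F A)) /\
    forall A : nat -> set (set S),
      (forall n, [/\ antichain B (A n), finite_set (A n) &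
                     (`I_(2 ^ n.+1)%N #<= A n)%card]) ->
      is_lim B (fun n => F (A n)) set0.

(* Main.v *)
Require Import Defs.
From mathcomp Require Import all_boot all_order all_algebra.
From mathcomp Require Import all_classical all_reals all_analysis.
From mathcomp Require Import zify lra.

Set Implicit Arguments.
Unset Strict Implicit.
Unset Printing Implicit Defensive.

Import Order.TTheory GRing.Theory Num.Theory.
Import numFieldNormedType.Exports.

(** A measure [m] gives both conditions by a Borel-Cantelli argument: elements of
    measure at most [2 ^- n] converge to [set0].  A countable partition has
    finite subfamilies of measure close to 1, and among [2 ^ n.+1] disjoint
    elements the one of least measure has measure at most [2 ^- n.+1].

    For the converse, let [F] be a concentrated choice.  Call an element
    [n]-small if it lies below [F A] for an antichain [A] with at least
    [2 ^ n.+1] elements.  A sequence whose [n]-th term is [n]-small converges to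
    [set0], and any [2 ^ n.+1] disjoint elements include an [n]-small one.  The
    sets of [n]-small elements behave like neighbourhoods of [set0], except that
    a null sequence need not enter them.  This is repaired by closing them under
    increasing limits ([small_limit]): weak distributivity, in the form of the
    diagonal argument [diagonal_vanishing], shows that the closure still
    shrinks to [set0], and a null sequence avoiding the closure would yield
    infinitely many disjoint elements that are not [n]-small
    ([small_limit_of_vanishing]).  Hence for every [n] there is [k] such that
    the union of two elements of the [k]-th closure is in the [n]-th one
    ([small_limitU]).

    This is enough for the combinatorial argument of Kalton and Roberts
    ([kalton_roberts]): the elements outside the [n]-th closure have a positive
    intersection number in the sense of Kelley, that is, some fixed fraction of
    any finite family of them has a common point.  A random bipartite graph of
    degree 4 provides the expander that the argument needs.  Weighting the
    complements of the closures suitably ([norming_weights]), a Hahn-Banach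
    argument ([additive_extension]) produces a finitely additive [mu] that is
    strictly positive on [B].

    Finally the infimum of [lim mu (x k)] over the sequences [x] of [B]
    increasing to [a] is a countably additive function of [a].  It remains
    strictly positive by weak distributivity, used once more through
    [diagonal_vanishing]. *)

(** * Expanding graphs and matchings *)

Lemma expn_leq_ffact m e : m ^ e <= (m + e) ^_ e.
Proof.
elim: e => // e IH; rewrite addnS ffactnS expnS leq_mul //=; lia.
Qed.

Lemma ffact_leq_expn m e : m ^_ e <= m ^ e.
Proof.
elim: e m => [|e IH] m //; rewrite ffactnS expnS leq_mul2l.
case: m => //= m; rewrite (leq_trans (IH _)) //.
by case: e {IH} => // e; rewrite leq_exp2r.
Qed.

Lemma bin_leq_exp2 n k : 'C(n, k) <= 2 ^ n.
Proof.
have := subset_leq_card (finset.subsetT [set A : {set 'I_n} | #|A| == k]).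
by rewrite card_draws -powersetT card_powerset cardsT card_ord.
Qed.

Lemma expnn_leq_fact e : e ^ e <= 4 ^ e * e`!.
Proof.
apply: leq_trans (expn_leq_ffact e e) _; rewrite -bin_ffact leq_mul2r.
by rewrite (leq_trans (bin_leq_exp2 _ _)) ?orbT // addnn -mul2n expnM.
Qed.

(** The loss of a factor [e`!] against [e ^ e] is only exponential; this is what
    makes the union bound below a geometric series. *)
Lemma bin_mul_expnn m e : 'C(m, e) * e ^ e <= (4 * m) ^ e.
Proof.
rewrite expnMn; apply: leq_trans (_ : 'C(m, e) * (4 ^ e * e`!) <= _).
  by rewrite leq_mul2l expnn_leq_fact orbT.
by rewrite mulnCA bin_ffact leq_mul2l ffact_leq_expn orbT.
Qed.

Section Concentrator.
Variables I J : finType.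
Implicit Types (E : {set I}) (L : {set J}) (R : {ffun I * 'I_4 -> J}).

(** [R] is a bipartite graph of degree 4, possibly with multiple edges: the edge
    leaving [i] through slot [t] ends at [R (i, t)]. *)
Definition nbrs R E := [set R u | u in [set u | u.1 \in E]].

Lemma card_slots E : #|[set u : I * 'I_4 | u.1 \in E]| = 4 * #|E|.
Proof.
rewrite mulnC -[4 in RHS]card_ord -(cardsT 'I_4) -cardsX.
by apply: eq_card => -[i t]; rewrite !inE /= andbT.
Qed.

(** The slots of [E] choose their ends in [L], all others freely in [J]. *)
Lemma card_nbrs_sub E L :
  #|[set R | nbrs R E \subset L]| =
  #|L| ^ (4 * #|E|) * #|J| ^ (4 * (#|I| - #|E|)).
Proof.
pose F (u : I * 'I_4) : {pred J} := [pred j | (u.1 \in E) ==> (j \in L)].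
have -> : #|[set R | nbrs R E \subset L]| = #|family F|.
  apply: eq_card => R; rewrite inE.
  apply/fintype.subsetP/familyP => [h u|h _ /imsetP[u Eu ->]].
    apply/implyP => Eu; apply: h; apply/imsetP; exists u => //.
    by rewrite inE.
  by have := h u; rewrite !inE in Eu *; rewrite Eu.
rewrite card_family /image_mem foldrE big_map big_enum /=.
rewrite (bigID (fun u : I * 'I_4 => u.1 \in E)) /=; congr (_ * _).
  rewrite (eq_bigr (fun=> #|L|)) => [|u Eu]; last first.
    by apply: eq_card => j; rewrite !inE Eu.
  by rewrite -card_slots -prod_nat_const; apply: eq_bigl => u; rewrite inE.
rewrite (eq_bigr (fun=> #|J|)) => [|u Eu]; last first.
  by apply: eq_card => j; rewrite !inE (negbTE Eu).
have -> : #|I| - #|E| = #|~: E| by rewrite -(cardsC E) addKn.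
by rewrite -card_slots -prod_nat_const; apply: eq_bigl => u; rewrite !inE.
Qed.

(** The first factor bounds the number of graphs in which some set of [e]
    vertices has all its neighbours in a set of size [2 * e].  They are at most a
    fraction [2 ^- e] of all graphs because the quotient is at most the [e]-th
    power of [256 * #|I| * e / #|J| ^ 2]. *)
Lemma bad_count_bound k e : 512 * #|I| * k <= #|J| ^ 2 -> 0 < e <= k -> e <= #|I| ->
  ('C(#|I|, e) * ('C(#|J|, 2 * e) *
    ((2 * e) ^ (4 * e) * #|J| ^ (4 * (#|I| - e))))) * 2 ^ e <= #|J| ^ (4 * #|I|).
Proof.
set m := #|I|; set l := #|J| => hk /andP[e0 ek] em.
have -> : 4 * m = 4 * e + 4 * (m - e) by lia.
rewrite [X in _ <= X]expnD; set z := l ^ (4 * (m - e)).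
suff : 'C(m, e) * 'C(l, 2 * e) * (2 * e) ^ (4 * e) * 2 ^ e <= l ^ (4 * e).
  by move=> h; apply: leq_trans (leq_mul h (leqnn z)); rewrite !mulnA; lia.
have h1 := bin_mul_expnn m e; have h2 := bin_mul_expnn l (2 * e).
have -> : 4 * e = 2 * e + 2 * e by lia.
rewrite expnD [X in _ * (X * _)]expnMn.
have -> : e ^ (2 * e) = e ^ e * e ^ e by rewrite mul2n -addnn expnD.
apply: leq_trans (_ : (4 * m) ^ e * (4 * l) ^ (2 * e) * (2 ^ (2 * e) * e ^ e * 2 ^ e) <= _).
  apply: leq_trans (leq_mul (leq_mul h1 h2) (leqnn _)).
  by rewrite leq_eqVlt; apply/orP; left; apply/eqP; lia.
rewrite expnD !(expnM _ 2) -!expnMn leq_exp2r //.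
have hh : 512 * m * e <= l ^ 2 by apply: leq_trans hk; rewrite leq_mul2l ek orbT.
by apply: leq_trans (leq_mul hh (leqnn _)); lia.
Qed.

Lemma superset_card (T : finType) (A : {set T}) n : #|A| <= n <= #|T| ->
  exists2 L : {set T}, #|L| = n & A \subset L.
Proof.
move=> /andP[An nT]; pose s := take (n - #|A|) (enum (~: A)).
have sC : {subset s <= ~: A} by move=> x /mem_take; rewrite mem_enum.
exists (A :|: [set x in s]); last exact: finset.subsetUl.
rewrite cardsU finset.disjoint_setI0 ?cards0 ?subn0; last first.
  rewrite disjoint_sym; apply/pred0P => x /=; rewrite inE.
  by apply: contraTF isT => /andP[/sC]; rewrite inE => /negbTE ->.
rewrite cardsE (card_uniqP _) ?take_uniq ?enum_uniq // size_takel ?subnKC //.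
by rewrite -cardE; have := cardsC A; lia.
Qed.

(** A random graph works: the fractions of graphs that are bad at size [e] add up
    to at most the sum of [2 ^- e] over [1 <= e <= k], which is less than 1. *)
Lemma concentrator_exists k : 512 * #|I| * k <= #|J| ^ 2 -> 0 < #|J| ->
  exists R, forall E, 0 < #|E| <= k -> 2 * #|E| < #|nbrs R E|.
Proof.
move=> hk J0; apply: contrapT => none.
pose bad (e : 'I_k) E L R := [&& #|E| == e.+1, #|L| == 2 * e.+1 & nbrs R E \subset L].
have ex_bad R : exists e, exists E, exists L, bad e E L R.
  have [E /andP[E0 Ek] nE] : exists2 E : {set I}, 0 < #|E| <= k & #|nbrs R E| <= 2 * #|E|.
    apply: contrapT => hR; apply: none; exists R => E hE.
    by rewrite ltnNge; apply/negP => nE; apply: hR; exists E.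
  have lE : 2 * #|E| <= #|J|.
    rewrite -(@leq_exp2r _ _ 2) //; apply: leq_trans hk; rewrite -mulnn.
    have h : #|E| * #|E| <= #|I| * k := leq_mul (max_card (mem E)) Ek.
    by move: #|E| #|I| h => x y h; lia.
  have e_lt : #|E|.-1 < k by lia.
  have [L cL nL] : exists2 L : {set J}, #|L| = 2 * #|E| & nbrs R E \subset L.
    by apply: superset_card; rewrite nE.
  by exists (Ordinal e_lt), E, L; rewrite /bad cL nL /= prednK ?eqxx.
set T := #|J| ^ (4 * #|I|).
have cardT : #|{ffun I * 'I_4 -> J}| = T.
  by rewrite card_ffun card_prod card_ord mulnC.
have T0 : 0 < T by rewrite expn_gt0 J0.
have le1 : T <= \sum_(e < k) \sum_E \sum_L #|[set R | bad e E L R]|.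
  rewrite -cardT -sum1_card.
  under [X in _ <= X]eq_bigr => e _.
    under eq_bigr => E _.
      under eq_bigr => L _. rewrite -sum1_card big_mkcond /=. over.
      rewrite exchange_big /=. over.
    rewrite exchange_big /=. over.
  rewrite exchange_big /=; apply: leq_sum => R _.
  have [e [E [L b]]] := ex_bad R.
  rewrite (bigD1 e) //= (bigD1 E) //= (bigD1 L) //= inE b; lia.
have le2 (e : 'I_k) : (\sum_E \sum_L #|[set R | bad e E L R]|) * 2 ^ e.+1 <= T.
  have [em|em] := leqP e.+1 #|I|; last first.
    rewrite big1 // => E _; rewrite big1 // => L _; apply/eqP; rewrite cards_eq0.
    apply/eqP/setP => R; rewrite !inE; apply/negbTE/negP => /andP[/eqP cE _].
    by have := max_card (mem E); rewrite cE leqNgt em.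
  apply: leq_trans (bad_count_bound hk _ em); last by rewrite /= ltn_ord.
  rewrite leq_mul2r; apply/orP; right.
  rewrite -card_draws -sum1_card big_distrl [leqRHS]big_mkcond /=; apply: leq_sum => E _.
  rewrite inE mul1n; case: eqP => cE; last first.
    rewrite big1 // => L _; apply/eqP; rewrite cards_eq0.
    by apply/eqP/setP => R; rewrite !inE /bad; case: eqP.
  rewrite -card_draws -sum1_card big_distrl [leqRHS]big_mkcond /=; apply: leq_sum => L _.
  rewrite inE mul1n; case: eqP => cL; last first.
    rewrite leqn0 cards_eq0; apply/eqP/setP => R; rewrite !inE /bad.
    by case: eqP => // _; case: eqP.
  rewrite -cL -cE -card_nbrs_sub subset_leq_card //.
  by apply/fintype.subsetP => R; rewrite !inE => /and3P[].
(* geometric series, with denominators cleared *)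
have le3 j (f : nat -> nat) : (forall e, e < j -> f e * 2 ^ e.+1 <= T) ->
    (\sum_(e < j) f e) * 2 ^ j <= T * (2 ^ j - 1).
  elim: j => [|j IH] hf; first by rewrite big_ord0.
  have := IH (fun e he => hf e (ltnW he)); have := hf j (ltnSn j).
  by rewrite big_ord_recr /= expnS; have := expn_gt0 2 j; nia.
pose f e := if insub e is Some e' then \sum_E \sum_L #|[set R | bad e' E L R]| else 0.
have := le3 k f.
rewrite (eq_bigr (fun e : 'I_k => \sum_E \sum_L #|[set R | bad e E L R]|)); last first.
  by move=> e _; rewrite /f valK.
have : 0 < 2 ^ k by rewrite expn_gt0.
have h : forall e, e < k -> f e * 2 ^ e.+1 <= T.
  by move=> e ek; rewrite /f insubT; apply: le2.
move=> k0 /(_ h); rewrite mulnBr muln1; have := leq_mul le1 (leqnn (2 ^ k)).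
by move=> /leq_trans h1 /h1; rewrite leqNgt ltn_subrL muln_gt0 T0 k0.
Qed.

(** A set [E] with more than [2 * #|E|] neighbours but only [4 * #|E|] outgoing
    edges has a neighbour reached by a single edge.  The origin of that edge can
    be matched along it without any conflict, and the rest of [E] is matched by
    induction; Hall's theorem is thereby avoided. *)
Lemma matching_of_expansion k R :
  (forall E, 0 < #|E| <= k -> 2 * #|E| < #|nbrs R E|) ->
  forall E, #|E| <= k -> exists f : I -> 'I_4, {in E &, injective (fun i => R (i, f i))}.
Proof.
move=> expR E; move: {2}#|E| (erefl #|E|) => n; elim: n E => [|n IH] E cE Ek.
  by exists (fun=> ord0) => i j; rewrite (cards0_eq cE) inE.
pose slots := [set u : I * 'I_4 | u.1 \in E].
have card_slotsE : #|slots| = 4 * #|E| := card_slots E.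
have [j jR uniq_j] : exists2 j, j \in nbrs R E & #|[set u in slots | R u == j]| <= 1.
  apply: contrapT => hj; have := expR E; rewrite Ek cE => /(_ isT).
  rewrite ltnNge -cE => /negP; apply.
  suff : \sum_(j in nbrs R E) 2 <= 4 * #|E| by rewrite sum_nat_const; lia.
  rewrite -card_slotsE -sum1_card (partition_big R (mem (nbrs R E))) /=; last first.
    by move=> u uE; apply: imset_f.
  apply: leq_sum => j jR; rewrite sum1dep_card ltnNge; apply/negP => le1.
  by apply: hj; exists j => //; apply: leq_trans le1; rewrite subset_leq_card.
have [[i t] uE jE] := imsetP jR; rewrite inE /= in uE.
have [||f inj_f] := IH (E :\ i).
- by move: cE; rewrite (cardsD1 i) uE => -[].
- by apply: leq_trans Ek; rewrite subset_leq_card ?finset.subsetDl.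
have no_clash b : b \in E -> b != i -> R (b, f b) <> R (i, t).
  move=> bE bi Rb; have /card_le1_eqP := uniq_j.
  move=> /(_ (b, f b) (i, t)); rewrite !inE /= bE uE jE Rb eqxx => /(_ isT isT) [eb _].
  by rewrite eb eqxx in bi.
exists (fun x => if x == i then t else f x) => a b aE bE /=.
case: (eqVneq a i) => [->|ai]; case: (eqVneq b i) => [->|bi] // Rab.
- by case: (no_clash b).
- by case: (no_clash a).
- by apply: inj_f => //; rewrite !inE ?ai ?bi.
Qed.
End Concentrator.

Local Open Scope classical_set_scope.

(** * Boolean algebras of sets and intersection numbers *)

Section Algebra.
Variables (S : Type) (B : set (set S)).
Hypothesis BA : boolean_algebra B.

Lemma ba0 : B set0. Proof. by case: BA. Qed.
Lemma baT : B setT. Proof. by case: BA. Qed.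
Lemma baU a b : B a -> B b -> B (a `|` b). Proof. by case: BA => _ _ h _ _; apply: h. Qed.
Lemma baI a b : B a -> B b -> B (a `&` b). Proof. by case: BA => _ _ _ h _; apply: h. Qed.
Lemma baC a : B a -> B (~` a). Proof. by case: BA => _ _ _ _ h; apply: h. Qed.
Lemma baD a b : B a -> B b -> B (a `\` b).
Proof. by move=> ? ?; rewrite setDE; apply: baI => //; apply: baC. Qed.

(** The fibres of [pattern c] are the atoms of the algebra generated by [c]. *)
Definition pattern (I : finType) (c : I -> set S) (x : S) : {set I} :=
  finset (fun i => `[< c i x >]).

Lemma pattern_in_algebra (I : finType) (c : I -> set S) (Q : pred {set I}) :
  (forall i, B (c i)) -> B [set x | Q (pattern c x)].
Proof.
move=> Bc.
pose atom (D : {set I}) := \big[setI/setT]_i (if i \in D then c i else ~` c i).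
have -> : [set x | Q (pattern c x)] = \big[setU/set0]_(D | Q D) atom D.
  rewrite -bigcup_pred; apply/seteqP; split=> x /=.
    move=> Qx; exists (pattern c x) => //; rewrite /atom -bigcap_seq => i _.
    by rewrite inE; case: asboolP.
  move=> [D /= QD]; rewrite /atom -bigcap_seq => Dx.
  suff -> : pattern c x = D by [].
  apply/setP => i; rewrite inE; have := Dx i (mem_index_enum i); case: ifP => _ ci.
    exact/asboolP.
  exact/asboolP.
apply: big_ind; [exact: ba0|exact: baU|move=> D _].
apply: big_ind; [exact: baT|exact: baI|move=> i _].
by case: ifP => _; [|apply: baC].
Qed.

(** Suppose that no point lies in a large fraction of the sets [c i].  Repeat each
    of them [M] times, and send the indices of the copies to a set [J] that is
    smaller by the factor [r], through an expanding graph of degree 4.  The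
    copies containing a given point [x] are few, so they can be matched
    injectively into [J].  Cutting each copy according to the edge used by its
    points splits it into 4 pieces, and pieces sent to the same element of [J] are
    disjoint.  A copy is not covered by 4 members of [V], so it has a piece
    outside [V]; by the pigeonhole principle [r] of these pieces are sent to
    the same element of [J], which contradicts the hypothesis on disjoint
    families. *)
Lemma kalton_roberts (V C : set (set S)) (r : nat) : [set: S] !=set0 -> (0 < r)%N ->
  (forall b : 'I_r -> set S, (forall i, B (b i)) ->
    (forall i j, i != j -> b i `&` b j = set0) -> exists i, V (b i)) ->
  (forall v : 'I_4 -> set S, (forall t, V (v t)) -> ~ C (\bigcup_t v t)) ->
  forall (I : finType) (c : I -> set S), (forall i, B (c i)) -> (forall i, C (c i)) ->
  exists x, (#|I| <= 512 * r ^ 2 * #|pattern c x|)%N.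
Proof.
move=> [x0 _] r0 meetV notC I c Bc Cc.
have [I0|I0] := posnP #|I|; first by exists x0; rewrite I0.
apply: contrapT => none.
set M := (512 * r ^ 2)%N in none.
have few x : (M * #|pattern c x| <= #|I|)%N.
  by rewrite leqNgt; apply/negP => lt; apply: none; exists x; apply: ltnW.
pose J := 'I_(512 * r * #|I|).
pose I' := (I * 'I_M)%type.
have cI' : #|{: I'}| = (M * #|I|)%N by rewrite card_prod card_ord mulnC.
have cJ : #|{: J}| = (512 * r * #|I|)%N by rewrite card_ord.
have [||R expR] := @concentrator_exists I' J #|I|.
- by rewrite cI' cJ /M; lia.
- by rewrite cJ !muln_gt0 r0.
have matching (E : {set I'}) : exists f : I' -> 'I_4, (#|E| <= #|I|)%N ->
    {in E &, injective (fun u => R (u, f u))}.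
  have [Ek|] := leqP #|E| #|I|; last by exists (fun=> ord0).
  by have [f fP] := matching_of_expansion expR Ek; exists f.
have [f fP] := choice matching.
pose c' (u : I') := c u.1.
have inj_f x : {in pattern c' x &, injective (fun u => R (u, f (pattern c' x) u))}.
  apply: fP; apply: leq_trans (few x).
  rewrite mulnC -[X in (_ * X)%N]card_ord -(cardsT 'I_M) -cardsX.
  apply: subset_leq_card; apply/fintype.subsetP => -[i t].
  rewrite !inE /= andbT => ci; exact/asboolP.
pose piece (u : I') (s : 'I_4) := [set x | c' u x /\ f (pattern c' x) u = s].
have Bpiece u s : B (piece u s).
  have -> : piece u s = [set x | (u \in pattern c' x) && (f (pattern c' x) u == s)].
    apply/seteqP; split=> x /=; rewrite inE.
      by move=> [ux /eqP ->]; rewrite andbT; apply/asboolP.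
    by move=> /andP[/asboolP ux /eqP].
  by apply: (@pattern_in_algebra _ c' (fun D => (u \in D) && (f D u == s))) => v; apply: Bc.
have cE u : c' u = \bigcup_t piece u t.
  apply/seteqP; split=> x; first by exists (f (pattern c' x) u).
  by move=> [t _ []].
have big u : exists t, ~ V (piece u t).
  apply: contrapT => h; apply: (notC (piece u)); last by rewrite -cE; apply: Cc.
  by move=> t; apply: contrapT => nV; apply: h; exists t.
have [t tP] := choice big.
pose h u := R (u, t u).
have [j hj] : exists j, (r <= #|[pred u | h u == j]|)%N.
  apply: contrapT => small; have : (#|{: I'}| <= \sum_(j : J) r.-1)%N.
    rewrite -sum1_card (partition_big h xpredT) //=; apply: leq_sum => j _.
    rewrite sum1_card; have [rj|] := leqP r #|[pred u | h u == j]|; last first.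
      by rewrite -[X in (_ < X)%N](prednK r0).
    by case: small; exists j.
  rewrite sum_nat_const cI' cJ /M.
  have : (0 < 512 * r * #|I|)%N by rewrite !muln_gt0 r0.
  have -> : (512 * r ^ 2 * #|I| = 512 * r * #|I| * r)%N by lia.
  by move=> N0; rewrite leq_pmul2l // leqNgt prednK ?leqnn.
pose u_ (i : 'I_r) : I' := enum_val (widen_ord hj i).
have u_j i : h (u_ i) = j by apply/eqP; exact: (enum_valP (widen_ord hj i)).
have [||i] := meetV (fun i => piece (u_ i) (t (u_ i))) => //; last exact: tP.
move=> i k ik; apply/seteqP; split=> // x [[ci fi] [ck fk]].
have /inj_f eik : R (u_ i, f (pattern c' x) (u_ i)) = R (u_ k, f (pattern c' x) (u_ k)).
  by rewrite fi fk -/(h _) -/(h _) !u_j.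
have /enum_val_inj : u_ i = u_ k by apply: eik; rewrite inE; apply/asboolP.
by move=> /(congr1 val) /= /val_inj /eqP; rewrite (negbTE ik).
Qed.

End Algebra.

(** * Order convergence and weak distributivity *)

Section IncreasesTo.
Variables (S : Type) (B : set (set S)).
Hypothesis BA : boolean_algebra B.
Implicit Types x y : nat -> set S.

Definition increases_to x (l : set S) :=
  [/\ forall n, B (x n), forall n k, (n <= k)%N -> x n `<=` x k &
      is_sup B (range x) l].

Lemma increases_to_sub x l n : increases_to x l -> x n `<=` l.
Proof. by case=> _ _ [_ + _]; apply; exists n. Qed.

Lemma increases_toB x l : increases_to x l -> B l.
Proof. by case=> _ _ []. Qed.

Lemma increases_to_min x l d : increases_to x l -> B d -> (forall n, x n `<=` d) -> l `<=` d.
Proof. by case=> _ _ [_ _ h] Bd xd; apply: h => // _ [n _ <-]. Qed.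

Lemma increases_to_cst a : B a -> increases_to (fun=> a) a.
Proof.
move=> Ba; split=> [//|? ? _|]; first exact: subset_refl.
by split=> [//|_ [_ _ <-] //|t _ h]; apply: h; exists 0%N.
Qed.

Lemma increases_toI x l b : B b -> increases_to x l ->
  increases_to (fun n => x n `&` b) (l `&` b).
Proof.
move=> Bb xl; have [Bx xmono _] := xl; split=> [n|n k nk|]; first exact: baI.
  by apply: setSI; apply: xmono.
split=> [|_ [n _ <-]|t Bt xt].
- by apply: baI => //; apply: increases_toB xl.
- by apply: setSI; apply: increases_to_sub xl.
- have h : l `<=` t `|` ~` b.
    apply: increases_to_min xl _ _ => [|n z xz]; first by apply: baU => //; apply: baC.
    have [bz|] := pselect (b z); last by right.
    by left; apply: (xt (x n `&` b)); [exists n|split].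
  by move=> z [/h[//|nb] bz].
Qed.

Lemma increases_toU x y l l' : increases_to x l -> increases_to y l' ->
  increases_to (fun n => x n `|` y n) (l `|` l').
Proof.
move=> xl yl; have [Bx xmono _] := xl; have [By ymono _] := yl.
split=> [n|n k nk|]; first exact: baU.
  by apply: setUSS; [apply: xmono|apply: ymono].
split=> [|_ [n _ <-]|t Bt xt].
- by apply: baU => //; [apply: increases_toB xl|apply: increases_toB yl].
- by apply: setUSS; [apply: increases_to_sub xl|apply: increases_to_sub yl].
- rewrite subUset; split;
    [apply: increases_to_min xl _ _|apply: increases_to_min yl _ _] => // n z xz.
    by apply: (xt (x n `|` y n)); [exists n|left].
  by apply: (xt (x n `|` y n)); [exists n|right].
Qed.

End IncreasesTo.

Section Sigma.
Variables (S : Type) (B : set (set S)).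
Hypothesis BS : boolean_sigma_algebra B.
Let BA : boolean_algebra B := BS.1.
Implicit Types a b s t : nat -> set S.

(** Convergence to [set0] in [B], by domination by a decreasing sequence of
    infimum [set0] in [B]. *)
Definition vanishing a := exists s,
  [/\ forall n, B (s n), forall n k, (n <= k)%N -> s k `<=` s n,
      forall n, a n `<=` s n &
      forall d, B d -> (forall n, d `<=` s n) -> d = set0].

Lemma vanishing_sub a b : (forall n, b n `<=` a n) -> vanishing a -> vanishing b.
Proof.
by move=> ba [s [Bs smono as_ s0]]; exists s; split=> // n; apply: subset_trans (as_ n).
Qed.

Lemma vanishingU a b : vanishing a -> vanishing b -> vanishing (fun n => a n `|` b n).
Proof.
move=> [s [Bs smono as_ s0]] [t [Bt tmono bt t0]].
exists (fun n => s n `|` t n); split=> [n|n k nk|n|d Bd dst].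
- exact: baU.
- by apply: setUSS; [apply: smono|apply: tmono].
- by apply: setUSS.
- apply: s0 => // m; rewrite -setD_eq0; apply: t0 => [|n]; first exact: baD.
  move=> x [dx sx]; have [sx'|] := dst (maxn m n) x dx.
    by case: sx; apply: smono sx'; exact: leq_maxl.
  by apply: tmono; exact: leq_maxr.
Qed.

Lemma countable_tail a n : countable [set a k | k in [set k | (n <= k)%N]].
Proof. exact: card_le_trans (card_image_le _ _) (countableP _). Qed.

Lemma tail_sup a : (forall n, B (a n)) -> exists s, forall n,
  is_sup B [set a k | k in [set k | (n <= k)%N]] (s n).
Proof.
move=> Ba; suff /choice[s sP] : forall n, exists l,
  is_sup B [set a k | k in [set k | (n <= k)%N]] l by exists s.
move=> n; have [||] := BS.2 [set a k | k in [set k | (n <= k)%N]] => //.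
  by move=> _ [k _ <-].
exact: countable_tail.
Qed.

Lemma tail_inf a : (forall n, B (a n)) -> exists s, forall n,
  is_inf B [set a k | k in [set k | (n <= k)%N]] (s n).
Proof.
move=> Ba; suff /choice[s sP] : forall n, exists l,
  is_inf B [set a k | k in [set k | (n <= k)%N]] l by exists s.
move=> n; have [||] := BS.2 [set a k | k in [set k | (n <= k)%N]] => //.
  by move=> _ [k _ <-].
exact: countable_tail.
Qed.

Lemma vanishing_of_tail_sup a s :
  (forall n, is_sup B [set a k | k in [set k | (n <= k)%N]] (s n)) ->
  (forall d, B d -> (forall n, d `<=` s n) -> d = set0) -> vanishing a.
Proof.
move=> ssup s0; exists s; split=> //.
- by move=> n; case: (ssup n).
- move=> n k nk; case: (ssup k) => _ _; apply; first by case: (ssup n).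
  move=> _ [j /= kj <-]; case: (ssup n) => _ + _; apply.
  by exists j => //=; apply: leq_trans nk kj.
- by move=> n; case: (ssup n) => _ + _; apply; exists n => //=.
Qed.

Lemma vanishing_of_lim0 a : is_lim B a set0 -> vanishing a.
Proof.
move=> [[s [ssup [_ _ s0]]] _]; apply: vanishing_of_tail_sup ssup _ => d Bd ds.
by apply/seteqP; split=> //; apply: s0 => // _ [n _ <-].
Qed.

Lemma lim0_of_vanishing a : (forall n, B (a n)) -> vanishing a -> is_lim B a set0.
Proof.
move=> Ba [s [Bs smono as_ s0]].
have [u usup] := tail_sup Ba; have [v vinf] := tail_inf Ba; split.
  exists u; split=> //; split=> [|? _|d Bd du]; [exact: ba0|exact: sub0set|].
  rewrite (s0 d) // => n; apply: subset_trans (du (u n) _) _; first by exists n.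
  case: (usup n) => _ _; apply=> // _ [k /= nk <-].
  by apply: subset_trans (as_ k) _; apply: smono.
exists v; split=> //; split=> [|_ [n _ <-]|? _ _]; [exact: ba0| |exact: sub0set].
rewrite (s0 (v n)) => [//||k]; first by case: (vinf n).
apply: subset_trans (_ : a (maxn n k) `<=` _).
  by case: (vinf n) => _ + _; apply; exists (maxn n k) => //=; exact: leq_maxl.
by apply: subset_trans (as_ _) _; apply: smono; exact: leq_maxr.
Qed.

Lemma vanishing_of_limT a : is_lim B a setT -> vanishing (fun n => ~` a n).
Proof.
move=> [_ [s [sinf [_ _ sT]]]]; exists (fun n => ~` s n); split.
- by move=> n; apply: baC => //; case: (sinf n).
- move=> n k nk; apply: subsetC; case: (sinf k) => _ _; apply; first by case: (sinf n).
  move=> _ [j /= kj <-]; case: (sinf n) => _ + _; apply.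
  by exists j => //=; apply: leq_trans nk kj.
- by move=> n; apply: subsetC; case: (sinf n) => _ + _; apply; exists n => //=.
- move=> d Bd ds; apply/seteqP; split=> // x dx.
  suff /(_ x I)/(_ dx) : setT `<=` ~` d by [].
  apply: sT; first exact: baC.
  by move=> _ [n _ <-]; rewrite -[s n]setCK; apply: subsetC.
Qed.

Lemma limT_of_vanishing a : (forall n, B (a n)) ->
  vanishing (fun n => ~` a n) -> is_lim B a setT.
Proof.
move=> Ba [s [Bs smono as_ s0]].
have [u usup] := tail_sup Ba; have [v vinf] := tail_inf Ba; split.
  exists u; split=> //; split=> [|_ [n _ <-]|? _ _]; [exact: baT| |exact: subsetT].
  rewrite -[u n]setCK -setC0; apply: subsetC; rewrite (s0 (~` u n)) // => [|k].
    by apply: baC => //; case: (usup n).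
  apply: subset_trans (_ : ~` a (maxn n k) `<=` _).
    apply: subsetC; case: (usup n) => _ + _; apply; exists (maxn n k) => //=.
    exact: leq_maxl.
  by apply: subset_trans (as_ _) _; apply: smono; exact: leq_maxr.
exists v; split=> //; split=> [|? _|d Bd vd]; [exact: baT|exact: subsetT|].
rewrite -[d]setCK -setC0; apply: subsetC; rewrite (s0 (~` d)) // => [|n]; first exact: baC.
rewrite -[s n]setCK; apply: subsetC; apply: subset_trans (vd (v n) _); last by exists n.
case: (vinf n) => _ _; apply=> [|_ [k /= nk <-]]; first exact: baC.
by rewrite -[a k]setCK; apply: subsetC; apply: subset_trans (as_ k) _; apply: smono.
Qed.

(** Weak distributivity is applied to the partitions [W n] of the unit into
    [~` l n] and the successive increments of [x n]: a finite part of [W n] lies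
    below [~` l n `|` x n k] for some [k]. *)
Lemma diagonal_vanishing (WD : weakly_distributive B) (x : nat -> nat -> set S)
    (l : nat -> set S) :
  (forall n, increases_to B (x n) (l n)) ->
  exists k : nat -> nat, vanishing (fun n => l n `\` x n (k n)).
Proof.
move=> xl.
pose g n j := if j is j'.+1 then seqD (x n) j' else ~` l n.
pose W n := [set w | w <> set0 /\ exists j, g n j = w].
have Bx n j : B (x n j) by case: (xl n).
have Bl n : B (l n) by exact: increases_toB (xl n).
have xmono n : nondecreasing_seq (x n).
  by case: (xl n) => _ h _ i j ij; apply/subsetPset; apply: h.
have seqD_sub n j : seqD (x n) j `<=` x n j by case: j => //= j; apply: subDsetl.
have Bg n j : B (g n j).
  case: j => [|[|j]] /=; first exact: baC.
    exact: Bx.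
  exact: baD.
have g_disj n i j : g n i `&` g n j !=set0 -> i = j.
  have aux k : g n 0 `&` g n k.+1 = set0.
    apply/seteqP; split=> // y [/= ly /seqD_sub]; by move/(increases_to_sub (xl n)).
  case: i j => [|i] [|j] //.
  - by rewrite aux => -[].
  - by rewrite setIC aux => -[].
  - by move=> h; congr _.+1; apply: (trivIset_seqD (xmono n)).
have WP n : countable (W n) /\ maximal_antichain B (W n).
  split.
    apply: (@sub_countable _ _ _ (range (g n))); last first.
      exact: card_le_trans (card_image_le _ _) (countableP _).
    by apply: subset_card_le => w [_ [j <-]]; exists j.
  split; first split.
  - by move=> w [_ [j <-]].
  - by case.
  - move=> a b [_ [i <-]] [_ [j <-]] ab; apply: contrapT => /eqP/set0P/g_disj ij.
    by apply: ab; rewrite ij.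
  - split=> //; first exact: baT.
    move=> d Bd Wd; have gd j : g n j `<=` d.
      by have [->//|/eqP gj] := eqVneq (g n j) set0; apply: Wd; split=> //; exists j.
    have xd j : x n j `<=` d.
      elim: j => [|j IH]; first exact: (gd 1).
      by move=> y xy; have [/IH//|nxy] := pselect (x n j y); apply: (gd j.+2); split.
    have ld := increases_to_min (xl n) Bd xd.
    by move=> y _; have [/ld//|] := pselect (l n y); apply: (gd 0).
have [E [EW /vanishing_of_limT E1]] := WD W WP.
(* [k] is the largest index of an increment occurring in [E n] *)
have bounded n : exists k, \bigcup_(e in E n) e `<=` ~` l n `|` x n k.
  have [/finite_seqP [s Es] EWn] := EW n.
  have /choice[k kP] : forall e, exists k, E n e -> e `<=` ~` l n `|` x n k.
    move=> e; have [/EWn[_ [j <-]]|] := pselect (E n e); last by exists 0.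
    by exists j.-1 => _; case: j => [|j] y /= yg; [left|right; exact: seqD_sub yg].
  exists (\max_(e <- s) k e) => y [e Ee /(kP e Ee)[ly|xy]]; [by left|right].
  case: (xl n) => _ h _; apply: h xy.
  by apply: leq_bigmax_seq => //; move: Ee; rewrite Es.
have [k kP] := choice bounded.
exists k; apply: vanishing_sub E1 => n y [ly nxy] Ey.
by have [] := kP n y Ey.
Qed.
End Sigma.

Local Open Scope ring_scope.

(** * Finitely additive functions above a weight *)

Section Extension.
Variables (R : realType) (S : Type) (delta : set S -> R).

Definition excess (s : seq (set S)) (x : S) : R := \sum_(c <- s) (\1_c x - delta c).

(** Additive monoids of functions, to be thought of as sets of functions of
    nonnegative integral.  Closure under addition is enough: multiplication by
    real scalars is recovered when the integral is defined as a supremum. *)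
Definition proper_monoid (K : set (S -> R)) : Prop :=
  [/\ forall s f, (forall x, excess s x <= f x) -> K f,
      forall f g, K f -> K g -> K (fun x => f x + g x) &
      ~ K (fun=> -1)].

Hypothesis delta_norming : forall s, ~ forall x, excess s x <= -1.

Lemma excess_cat s t x : excess (s ++ t) x = excess s x + excess t x.
Proof. by rewrite /excess big_cat. Qed.

Lemma proper_monoid0 K : proper_monoid K -> K (fun=> 0).
Proof. by case=> Kgap _ _; apply: (Kgap [::]) => x; rewrite /excess big_nil. Qed.

Lemma proper_monoid_up K f g : proper_monoid K ->
  K f -> (forall x, f x <= g x) -> K g.
Proof.
case=> Kgap Kadd _ Kf fg.
have -> : g = (fun x => f x + (g x - f x)) by apply/funext => x; rewrite subrKC.
by apply: Kadd => //; apply: (Kgap [::]) => x; rewrite /excess big_nil subr_ge0.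
Qed.

Lemma proper_monoid_muln K f n : proper_monoid K -> K f -> K (fun x => n%:R * f x).
Proof.
move=> KP Kf; elim: n => [|n IH].
  by apply: proper_monoid_up (proper_monoid0 KP) _ => // x; rewrite mul0r.
have -> : (fun x => n.+1%:R * f x) = (fun x => f x + n%:R * f x).
  by apply/funext => x; rewrite -add1n natrD mulrDl mul1r.
by case: KP => _ Kadd _; apply: Kadd.
Qed.

(** A maximal proper monoid is total, as in the proof of the Hahn-Banach theorem.
    If neither [f] nor [- f] belongs to [K], adding either of them makes [-1]
    appear, and a combination of the two relations cancels [f]. *)
Lemma total_monoid_exists : exists2 K, proper_monoid K &
  forall f, K f \/ K (fun x => - f x).
Proof.
pose K0 := [set f : S -> R | exists s, forall x, excess s x <= f x].
have K0P : proper_monoid K0.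
  split; first by move=> s f sf; exists s.
    move=> f g [s sf] [t tg]; exists (s ++ t) => x; rewrite excess_cat.
    exact: lerD.
  by move=> [s] /delta_norming.
have [K [KP maxK]] : exists K, (K = set0 \/ proper_monoid K) /\
    forall L, K `<` L -> ~ (L = set0 \/ proper_monoid L).
  (* the empty set is admitted as a bound for the empty chain *)
  apply: (@Zorn_bigcup _ (fun K => K = set0 \/ proper_monoid K)) => F FP totF.
  have [[X FX X0]|allE] := pselect (exists2 X, F X & X <> set0); last first.
    left; apply/seteqP; split=> // f [X FX Xf].
    by apply: allE; exists X => // X0; rewrite X0 in Xf.
  right; have PX Y f : F Y -> Y f -> proper_monoid Y.
    by move=> /FP[->|].
  have [f0 Xf0] : X !=set0 by apply/set0P/eqP.
  split.
  - by move=> s f sf; exists X => //; case: (PX _ _ FX Xf0) => h _ _; apply: (h s).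
  - move=> f g [Y FY Yf] [Z FZ Zg].
    have [YZ|ZY] := totF _ _ FY FZ.
      by exists Z => //; case: (PX _ _ FZ Zg) => _ h _; apply: h => //; apply: YZ.
    by exists Y => //; case: (PX _ _ FY Yf) => _ h _; apply: h => //; apply: ZY.
  - by move=> [Y FY Y1]; case: (PX _ _ FY Y1).
have {KP} KP : proper_monoid K.
  case: KP => // K_0; exfalso; apply: (maxK K0); last by right.
  rewrite K_0; split => //= h; have := h (fun=> 0) _; apply.
  by exists [::] => x; rewrite /excess big_nil.
have [Kgap Kadd KN1] := KP.
have Kup := proper_monoid_up KP; have Kmul n f := @proper_monoid_muln _ f n KP.
have Kz := proper_monoid0 KP.
exists K => // f.
have witness g : ~ K g -> exists n k, K k /\ forall x, k x + n%:R * g x <= -1.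
  move=> nKg; apply: contrapT => none.
  pose L := [set h : S -> R | exists n k, K k /\ forall x, k x + n%:R * g x <= h x].
  apply: (maxK L); last first.
    right; split.
    - move=> s h sh; exists 0, h; split; first exact: (Kgap s).
      by move=> x; rewrite mul0r addr0.
    - move=> h h' [n [k [Kk kh]]] [n' [k' [Kk' kh']]].
      exists (n + n')%N, (fun x => k x + k' x); split; first exact: Kadd.
      by move=> x; rewrite natrD mulrDl addrACA lerD.
    - by [].
  split=> [h Kh|KL]; first by exists 0, h; split => // x; rewrite mul0r addr0.
  apply: nKg; apply: KL; exists 1, (fun=> 0); split => // x.
  by rewrite mul1r add0r.
apply: contrapT => /not_orP[/witness[n [k [Kk kf]]] /witness[n' [k' [Kk' kf']]]].
have n0 : n%:R >= 0 :> R by []. have n0' : n'%:R >= 0 :> R by [].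
apply: KN1; case: n kf n0 => [|n] kf n0.
  by apply: Kup Kk _ => x; have := kf x; rewrite mul0r addr0.
apply: (@Kup (fun x => n'%:R * k x + n.+1%:R * k' x)) => [|x].
  by apply: Kadd; exact: Kmul.
have := ler_wpM2l n0' (kf x); have := ler_wpM2l n0 (kf' x).
have n1 : 1 <= n.+1%:R :> R by rewrite ler1n.
lra.
Qed.

(** The value at [a] is the supremum of the reals [r] such that [\1_a - r] is in
    a total proper monoid: totality makes this supremum additive, and
    [\1_c - delta c] being in the monoid makes it at least [delta c]. *)
Lemma additive_extension : exists mu : set S -> R,
  [/\ forall a, 0 <= mu a, mu setT = 1,
      forall a b, a `&` b = set0 -> mu (a `|` b) = mu a + mu b &
      forall c, delta c <= mu c].
Proof.
have [K KP Ktot] := total_monoid_exists; have [Kgap Kadd KN1] := KP.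
have Kup := proper_monoid_up KP; have Kmul n f := @proper_monoid_muln _ f n KP.
have Kz := proper_monoid0 KP.
have Kcst r : K (fun=> r) -> 0 <= r.
  move=> Kr; rewrite leNgt; apply/negP => r0; apply: KN1.
  have [n hn] : exists n : nat, (- r)^-1 <= n%:R.
    by exists (Num.truncn (- r)^-1).+1; rewrite ltW // truncnS_gt.
  apply: Kup (Kmul n _ Kr) _ => _; have r0' : 0 < - r by lra.
  by rewrite -lerN2 opprK -mulrN -ler_pdivrMr // div1r.
pose A (a : set S) := [set r | K (fun x => \1_a x - r)].
have A1 a r : A a r -> r <= 1.
  move=> Ar; rewrite -subr_ge0; apply: Kcst; apply: Kup Ar _ => x.
  by rewrite lerD2r indicE; case: (x \in a).
have A0 a : A a 0 by apply: Kup Kz _ => x; rewrite subr0 indicE.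
have supA a : has_sup (A a) by split; [exists 0|exists 1 => r; apply: A1].
have geA a r : A a r -> r <= sup (A a) by move=> Ar; apply: ub_le_sup => //; case: (supA a).
have leA a r : r < sup (A a) -> A a r.
  move=> rs; have /(@sup_adherent _ _ _)/(_ (supA a)) [r' Ar'] : 0 < sup (A a) - r by lra.
  move=> rr'; apply: Kup Ar' _ => x; lra.
have gtA a r : sup (A a) < r -> K (fun x => r - \1_a x).
  move=> sr; case: (Ktot (fun x => \1_a x - r)) => [/geA|]; first by lra.
  by move/Kup; apply => x; rewrite opprB.
exists (fun a => sup (A a)); split.
- by move=> a; apply: geA.
- apply/eqP; rewrite eq_le; apply/andP; split.
    by apply: ge_sup; [exists 0|move=> r; apply: A1].
  by apply: geA; apply: Kup Kz _ => x; rewrite indicT subrr.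
- move=> a b ab; have E x : \1_(a `|` b) x = \1_a x + \1_b x :> R.
    rewrite !indicE in_setU; have [xa|] := boolP (x \in a); last by rewrite add0r.
    have [xb|] := boolP (x \in b); last by rewrite addr0.
    by have : (a `&` b) x by [split; exact: set_mem]; rewrite ab.
  (* a difference [d] between the sides would put a negative constant in [K] *)
  apply/eqP; rewrite eq_le; apply/andP; split; rewrite leNgt; apply/negP => lt.
    set d := sup (A (a `|` b)) - (sup (A a) + sup (A b)).
    have da : K (fun x => sup (A a) + d / 3 - \1_a x) by apply: gtA; rewrite /d; lra.
    have db : K (fun x => sup (A b) + d / 3 - \1_b x) by apply: gtA; rewrite /d; lra.
    have dab : A (a `|` b) (sup (A (a `|` b)) - d / 6) by apply: leA; rewrite /d; lra.
    have /Kcst : K (fun=> - d / 6); last by rewrite /d; lra.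
    by apply: Kup (Kadd _ _ (Kadd _ _ da db) dab) _ => x; rewrite E /d; lra.
  set d := sup (A a) + sup (A b) - sup (A (a `|` b)).
  have da : A a (sup (A a) - d / 3) by apply: leA; rewrite /d; lra.
  have db : A b (sup (A b) - d / 3) by apply: leA; rewrite /d; lra.
  have dab : K (fun x => sup (A (a `|` b)) + d / 6 - \1_(a `|` b) x).
    by apply: gtA; rewrite /d; lra.
  have /Kcst : K (fun=> - d / 6); last by rewrite /d; lra.
  by apply: Kup (Kadd _ _ (Kadd _ _ da db) dab) _ => x; rewrite E /d; lra.
- move=> c; apply: geA; apply: (Kgap [:: c]) => x; by rewrite /excess big_seq1.
Qed.
End Extension.

Lemma sum_half_le1 (R : realType) N : \sum_(n < N) (2^-1 : R) ^+ n.+1 <= 1.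
Proof.
suff -> : \sum_(n < N) (2^-1 : R) ^+ n.+1 = 1 - 2^-1 ^+ N.
  by rewrite lerBlDr lerDl exprn_ge0.
elim: N => [|N IH]; first by rewrite big_ord0 expr0 subrr.
by rewrite big_ord_recr /= IH exprS; lra.
Qed.

Definition hits (S : Type) (s : seq (set S)) (x : S) : nat :=
  count (fun c : set S => `[< c x >]) s.

(** A family of sets that all belong to [C n] meets at some point with multiplicity
    at least its size over [M n], so the weight [1 / M n] is norming on [C n].
    With the fraction [2 ^- n.+1] of that weight on [C n], the total weight of any
    family is at most the largest multiplicity of a point in it. *)
Lemma norming_weights (R : realType) (S : Type) (C : nat -> set (set S)) (M : nat -> nat) :
  (forall n, (0 < M n)%N) ->
  (forall n s, all (fun c => `[< C n c >]) s -> exists x, (size s <= M n * hits s x)%N) ->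
  exists delta : set S -> R,
    (forall n c, C n c -> 0 < delta c) /\ forall s, ~ forall x, excess delta s x <= -1.
Proof.
move=> M0 CM.
have [rank rankP] : {rank : set S -> nat & forall c n, C n c -> C (rank c) c}.
  apply: (@choice _ _ (fun c k => forall n, C n c -> C k c)) => c.
  have [[n Cn]|none] := pselect (exists n, C n c); first by exists n.
  by exists 0%N => n Cn; case: none; exists n.
pose w n : R := 2^-1 ^+ n.+1 / (M n)%:R.
pose level n c := `[< C n c >] && (rank c == n).
pose delta c := if `[< C (rank c) c >] then w (rank c) else 0.
have w0 n : 0 < w n by rewrite divr_gt0 ?exprn_gt0 ?ltr0n.
exists delta; split=> [n c /rankP Cc|s small]; first by rewrite /delta asboolT.
(* [D] is the total weight; the aim is [D <= D - 1] *)
pose D := \sum_(c <- s) delta c.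
have hitsD x : (hits s x)%:R <= D - 1.
  have := small x; rewrite /excess sumrB -/D.
  have -> : \sum_(c <- s) \1_c x = (hits s x)%:R :> R; last by lra.
  rewrite /hits -sum1_count natr_sum [RHS]big_mkcond; apply: eq_bigr => c _.
  by rewrite indicE; case: asboolP => cx; [rewrite mem_set|rewrite memNset].
have [x0 _] := CM 0%N [::] isT.
have D1 : 0 <= D - 1 by apply: le_trans (hitsD x0).
pose N := (\max_(c <- s) rank c).+1.
have DE : D = \sum_(n < N) w n * (count (level n) s)%:R.
  transitivity (\sum_(c <- s) \sum_(n < N) (if level n c then w n else 0)).
    rewrite /D !big_seq; apply: eq_bigr => c cs.
    have rN : (rank c < N)%N by rewrite ltnS; apply: leq_bigmax_seq.
    rewrite (bigD1 (Ordinal rN)) //= /level eqxx andbT -/(delta c) big1 ?addr0 // => n nr.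
    by case: eqP => [e|]; [case/eqP: nr; apply: val_inj|rewrite andbF].
  rewrite exchange_big /=; apply: eq_bigr => n _.
  rewrite -big_mkcond /= -sum1_count natr_sum mulr_sumr.
  by apply: eq_bigr => c _; rewrite mulr1.
suff : D <= D - 1 by lra.
rewrite {1}DE; apply: le_trans (_ : \sum_(n < N) 2^-1 ^+ n.+1 * (D - 1) <= _); last first.
  by rewrite -mulr_suml ler_piMl // sum_half_le1.
apply: ler_sum => n _; rewrite /w -mulrA ler_pM2l ?exprn_gt0 //.
have [|x] := CM n [seq c <- s | level n c].
  by apply/allP => c; rewrite mem_filter => /andP[/andP[]].
rewrite mulrC ler_pdivrMr ?ltr0n ?M0 // -size_filter => xs.
apply: le_trans (_ : (M n * hits s x)%:R <= _); last first.
  by rewrite natrM mulrC ler_pM2r ?ltr0n ?M0.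
rewrite ler_nat; apply: leq_trans xs _; rewrite leq_mul2l; apply/orP; right.
by rewrite /hits !count_filter; apply: sub_count => c /= /andP[].
Qed.

(** * Fragments of a uniformly concentrated algebra *)

Local Close Scope ring_scope.

Section Fragmentation.
Variables (S : Type) (B : set (set S)).
Hypothesis BS : boolean_sigma_algebra B.
Let BA : boolean_algebra B := BS.1.
Hypothesis WD : weakly_distributive B.
Variable F : set (set S) -> set S.
Hypothesis F_in : forall A, antichain B A -> finite_set A -> A !=set0 -> A (F A).
Definition large n A := [/\ antichain B A, finite_set A & (`I_(2 ^ n.+1)%N #<= A)%card].
Hypothesis F_lim : forall A : nat -> set (set S), (forall n, large n (A n)) ->
  is_lim B (fun n => F (A n)) set0.

(** [set0] is added for the case of an algebra without large antichains. *)
Definition small n := [set a : set S | B a /\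
  (a = set0 \/ exists2 A, large n A & a `<=` F A)].

Lemma large_le n m A : (n <= m)%N -> large m A -> large n A.
Proof.
move=> nm [aA fA cA]; split=> //; apply: card_le_trans cA.
by rewrite card_le_II leq_exp2l.
Qed.

Lemma small_vanishing a : (forall n, small n (a n)) -> vanishing B a.
Proof.
move=> sa; have [/choice[A0 A0P]|] := pselect (forall n, exists A, large n A).
  have /choice[A AP] : forall n, exists A, large n A /\ a n `<=` F A.
    move=> n; have [_ [->|[A LA aF]]] := sa n; last by exists A.
    by exists (A0 n); split=> //; exact: sub0set.
  apply: (@vanishing_sub _ _ (fun n => F (A n))) => [n|]; first by case: (AP n).
  by apply: vanishing_of_lim0; apply: F_lim => n; case: (AP n).
(* without antichains of size [2 ^ N.+1] all terms from [N] on are empty *)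
move=> /existsNP[N noN].
exists (fun n => if (n < N)%N then setT else set0); split.
- by move=> n; case: ifP => _; [exact: baT|exact: ba0].
- move=> n k nk; case: ifP => kN; last exact: sub0set.
  by rewrite (leq_ltn_trans nk kN).
- move=> n; case: ltnP => Nn; first exact: subsetT.
  have [_ [->//|[A /(large_le Nn) LA _]]] := sa n.
  by case: noN; exists A.
- by move=> d _ /(_ N); rewrite ltnn => ?; apply/seteqP; split.
Qed.

Lemma small_in_disjoint n (b : 'I_(2 ^ n.+1) -> set S) : (forall i, B (b i)) ->
  (forall i j, i != j -> b i `&` b j = set0) -> exists i, small n (b i).
Proof.
move=> Bb disj; have [[i bi0]|b_neq0] := pselect (exists i, b i = set0).
  by exists i; split=> //; left.
have inj_b : injective b.
  move=> i j bij; apply/eqP; apply: contrapT => /negP/disj; rewrite -bij setIid => bi0.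
  by apply: b_neq0; exists i.
have Lb : large n (range b).
  split; first split.
  - by move=> _ [i _ <-].
  - by move=> [i _ bi0]; apply: b_neq0; exists i.
  - move=> _ _ [i _ <-] [j _ <-] bij; apply: disj; apply/eqP => ij.
    by apply: bij; rewrite ij.
  - exact: finite_image.
  - rewrite (card_le_eqr (inj_card_eq (in2W inj_b))).
    by rewrite -(card_le_eqr (@card_II (2 ^ n.+1))).
have [Lanti Lfin _] := Lb.
have i0 : 'I_(2 ^ n.+1) by exists 0%N; rewrite expn_gt0.
have [i _ bi] : range b (F (range b)) by apply: F_in => //; exists (b i0), i0.
by exists i; split=> //; right; exists (range b); rewrite ?bi.
Qed.

(** The closure of [small n] under increasing limits.  As [small n] is downward
    closed, this is its sequential closure for order convergence. *)
Definition small_limit n :=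
  [set l : set S | exists x, increases_to B x l /\ forall k, small n (x k)].

(** The [n]-th term is the union of a term of the sequence [x n] of [small n] and
    of the remaining difference; a diagonal choice makes both vanish. *)
Lemma small_limit_vanishing a : (forall n, small_limit n (a n)) -> vanishing B a.
Proof.
move=> aV; have /choice[x xP] : forall n, exists x, increases_to B x (a n) /\
    forall k, small n (x k) := aV.
have [k kP] := diagonal_vanishing BS WD (fun n => (xP n).1).
have xv : vanishing B (fun n => x n (k n)).
  by apply: small_vanishing => n; case: (xP n) => _; apply.
apply: vanishing_sub (vanishingU BS kP xv) => n y ay.
by have [xy|nxy] := pselect (x n (k n) y); [right|left].
Qed.

(** Let [s] dominate [c] and suppose that no [c i] is in the closure.  Since
    [c i `\` s k] increases to [c i], it is not small for some [k]; necessarily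
    [i < k].  Iterating [i |-> k] from 0 gives infinitely many disjoint elements
    [c i `\` s k] that are not small, which is too many. *)
Lemma small_limit_of_vanishing c n : (forall k, B (c k)) -> vanishing B c ->
  exists k, small_limit n (c k).
Proof.
move=> Bc [s [Bs smono cs s0]]; apply: contrapT => none.
have /choice[g gP] : forall i, exists k, ~ small n (c i `\` s k).
  move=> i; apply: contrapT => allS; apply: none; exists i.
  exists (fun k => c i `\` s k); split=> [|k]; last first.
    by apply: contrapT => h; apply: allS; exists k.
  split=> [k|k m km|]; first exact: baD.
    by apply: setDS; apply: smono.
  split=> [//|_ [k _ <-]|t Bt h]; first exact: subDsetl.
  rewrite -setD_eq0; apply: s0 => [|k y [cy nty]]; first exact: baD.
  by apply: contrapT => nsy; apply: nty; apply: (h (c i `\` s k)); [exists k|split].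
have g_gt i : (i < g i)%N.
  rewrite ltnNge; apply/negP => gi; apply: (gP i); split; first exact: baD.
  by left; rewrite setD_eq0; apply: subset_trans (cs i) _; apply: smono.
pose j p := iter p g 0%N.
have j_mono p q : (p < q)%N -> (j p.+1 <= j q)%N.
  elim: q => // q IH; rewrite ltnS leq_eqVlt => /orP[/eqP ->//|/IH h].
  exact: leq_trans h (ltnW (g_gt _)).
have [|i si] := @small_in_disjoint n (fun p => c (j p) `\` s (j p.+1))
  (fun p => baD BA (Bc _) (Bs _)).
  have disj p q : (p < q)%N -> (c (j p) `\` s (j p.+1)) `&` (c (j q) `\` s (j q.+1)) = set0.
    move=> pq; apply/seteqP; split=> // y [[_ nsy] [cy _]].
    by apply: nsy; apply: smono (j_mono _ _ pq) _ (cs _ _ cy).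
  move=> p q; rewrite -val_eqE neq_ltn => /orP[|] pq; first exact: disj.
  by rewrite setIC; apply: disj.
by apply: (gP (j i)).
Qed.

(** Otherwise there are, for some [n], pairs in the [k]-th closures whose unions
    avoid the [n]-th closure; but these unions vanish as [k] grows. *)
Lemma small_limitU n : exists k, forall a b,
  small_limit k a -> small_limit k b -> small_limit n (a `|` b).
Proof.
apply: contrapT => /forallNP none.
have /choice[ab abP] : forall k, exists ab : set S * set S,
    [/\ small_limit k ab.1, small_limit k ab.2 & ~ small_limit n (ab.1 `|` ab.2)].
  move=> k; apply: contrapT => h; apply: (none k) => a b ka kb.
  by apply: contrapT => nab; apply: h; exists (a, b).
have B1 m a : small_limit m a -> B a by move=> [x [/increases_toB]].
have [k||k] := @small_limit_of_vanishing (fun k => (ab k).1 `|` (ab k).2) n.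
- by case: (abP k) => /B1 ? /B1 ? _; apply: baU.
- by apply: (vanishingU BS); apply: small_limit_vanishing => k; case: (abP k).
- by case: (abP k).
Qed.

Lemma small_limit_separates a : B a -> a <> set0 -> exists n, ~ small_limit n a.
Proof.
move=> Ba a0; apply: contrapT => /forallNP all_n; apply: a0.
have [s [_ _ as_ s0]] : vanishing B (fun=> a).
  by apply: small_limit_vanishing => n; apply: contrapT; apply: all_n.
exact: s0.
Qed.

Lemma small_limit_of_small n a : small n a -> small_limit n a.
Proof.
by move=> sa; exists (fun=> a); split=> //; apply: increases_to_cst; case: sa.
Qed.

(** Applying [small_limitU] twice, a set outside the [n]-th closure is not the
    union of 4 members of the [m]-th one. *)
Lemma fragment_hits n : [set: S] !=set0 -> exists2 M, (0 < M)%N &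
  forall s, all (fun c => `[< B c /\ ~ small_limit n c >]) s ->
    exists x, (size s <= M * hits s x)%N.
Proof.
move=> S0; have [k nk] := small_limitU n; have [m km] := small_limitU k.
exists (512 * (2 ^ m.+1) ^ 2)%N => [|s sC]; first by rewrite muln_gt0 !expn_gt0.
have [|||||x hx] := @kalton_roberts S B BA (small_limit m)
  [set c | ~ small_limit n c] (2 ^ m.+1) S0 _ _ _ 'I_(size s) (fun i => nth set0 s i).
- by rewrite expn_gt0.
- move=> b Bb disj; have [i /small_limit_of_small] := small_in_disjoint Bb disj.
  by exists i.
- move=> v vm; apply; have -> : \bigcup_t v t = (v 0%R `|` v 1%R) `|` (v 2%R `|` v 3%R).
    apply/seteqP; split=> y; last first.
      by move=> [[]|[]] vy; [exists 0%R|exists 1%R|exists 2%R|exists 3%R].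
    move=> [[[|[|[|[|//]]]] t4] _ vy]; [left; left|left; right|right; left|right; right];
      by move: vy; congr (v _ y); apply: val_inj.
  by apply: nk; apply: km.
- by move=> i; have /(all_nthP set0)/(_ i (ltn_ord i))/asboolP[] := sC.
- by move=> i; have /(all_nthP set0)/(_ i (ltn_ord i))/asboolP[] := sC.
exists x; move: hx; rewrite card_ord => hx; apply: leq_trans hx _.
rewrite leq_mul2l; apply/orP; right.
rewrite /hits -sum1_count (big_nth set0) big_mkord -sum1_card.
by apply: eq_leq; apply: eq_bigl => i; rewrite inE.
Qed.

Lemma fragmentation_measure (R : realType) : [set: S] !=set0 ->
  exists mu : set S -> R, [/\ forall a, (0 <= mu a)%R, mu setT = 1%R,
    forall a b, a `&` b = set0 -> mu (a `|` b) = (mu a + mu b)%R &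
    forall a, B a -> a <> set0 -> (0 < mu a)%R].
Proof.
move=> S0; have /choice[M MP] : forall n, exists M, (0 < M)%N /\
    forall s, all (fun c => `[< B c /\ ~ small_limit n c >]) s ->
    exists x, (size s <= M * hits s x)%N.
  by move=> n; have [M M0 MP] := fragment_hits n S0; exists M.
have [delta [delta_gt0 delta_norming]] :=
  @norming_weights R S (fun n c => B c /\ ~ small_limit n c) M
    (fun n => (MP n).1) (fun n => (MP n).2).
have [mu [mu_ge0 muT muU mu_ge]] := additive_extension delta_norming.
exists mu; split=> // a Ba a0; have [n nVa] := small_limit_separates Ba a0.
exact: lt_le_trans (delta_gt0 n a _) (mu_ge a).
Qed.

End Fragmentation.

Local Open Scope ring_scope.

(** * The countably additive part of a finitely additive function *)

Section FiniteAdditivity.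
Variables (R : realType) (S : Type) (B : set (set S)).
Hypothesis BA : boolean_algebra B.
Variable f : set S -> R.
Hypothesis fU : forall a b, B a -> B b -> a `&` b = set0 -> f (a `|` b) = f a + f b.

Lemma additive0 : f set0 = 0.
Proof. have := fU (ba0 BA) (ba0 BA) (setI0 _); rewrite setU0; lra. Qed.

Lemma additive_bigU (a : nat -> set S) N : (forall n, B (a n)) ->
  (forall i j, i <> j -> a i `&` a j = set0) ->
  B (\big[setU/set0]_(n < N) a n) /\
  f (\big[setU/set0]_(n < N) a n) = \sum_(n < N) f (a n).
Proof.
move=> Ba disj; elim: N => [|N [IHB IH]].
  by rewrite !big_ord0; split; [exact: ba0|exact: additive0].
rewrite !big_ord_recr /=; split; first exact: baU.
rewrite fU ?IH // -bigcup_mkord; apply/seteqP; split=> // z [[n /= nN anz] aNz].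
suff : (a n `&` a N) z by rewrite disj // => e; rewrite e ltnn in nN.
by split.
Qed.

End FiniteAdditivity.

Section Regularization.
Variables (R : realType) (S : Type) (B : set (set S)).
Hypothesis BS : boolean_sigma_algebra B.
Let BA : boolean_algebra B := BS.1.
Hypothesis WD : weakly_distributive B.
Variable mu : set S -> R.
Hypothesis mu_ge0 : forall a, 0 <= mu a.
Hypothesis muU : forall a b, a `&` b = set0 -> mu (a `|` b) = mu a + mu b.
Hypothesis mu_gt0 : forall a, B a -> a <> set0 -> 0 < mu a.

Lemma mu_le a b : a `<=` b -> mu a <= mu b.
Proof.
move=> ab; rewrite -(setDUK ab) muU ?lerDl //.
by rewrite setIDA setIC -setIDA setDv setI0.
Qed.

Lemma mu_subadd a b : mu (a `|` b) <= mu a + mu b.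
Proof.
have -> : a `|` b = a `|` (b `\` a).
  apply/seteqP; split=> z [az|]; [by left| |by left|by case; right].
  by move=> bz; have [az|naz] := pselect (a z); [left|right].
rewrite muU; last by rewrite setIDA setIC -setIDA setDv setI0.
by rewrite lerD2l mu_le //; apply: subDsetl.
Qed.

Lemma mu_bigU (y : nat -> set S) N :
  mu (\big[setU/set0]_(n < N) y n) <= \sum_(n < N) mu (y n).
Proof.
elim: N => [|N IH]; last first.
  rewrite !big_ord_recr /=; apply: le_trans (mu_subadd _ _) _; exact: lerD.
rewrite !big_ord0; have := muU (setI0 set0); rewrite setU0; lra.
Qed.

(** [sigma_part a] is the infimum of [lim mu (x k)] over the sequences [x] that
    increase to [a]; using upper bounds of [mu (x k)] avoids these limits. *)
Definition limit_bounds a : set R :=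
  [set r | exists x, increases_to B x a /\ forall k, mu (x k) <= r].

Definition sigma_part a : R := inf (limit_bounds a).

Lemma limit_bounds_inf a : B a -> has_inf (limit_bounds a).
Proof.
move=> Ba; split.
  by exists (mu a), (fun=> a); split=> //; apply: increases_to_cst.
by exists 0 => r [x [_ xr]]; apply: le_trans (xr 0%N).
Qed.

Lemma sigma_part_le a r : B a -> limit_bounds a r -> sigma_part a <= r.
Proof. by move=> Ba ar; apply: ge_inf => //; case: (limit_bounds_inf Ba). Qed.

Lemma sigma_part_near a e : B a -> 0 < e -> exists2 r, limit_bounds a r & r < sigma_part a + e.
Proof. by move=> Ba e0; apply: inf_adherent => //; apply: limit_bounds_inf. Qed.

Lemma sigma_part_ge0 a : B a -> 0 <= sigma_part a.
Proof.
move=> Ba; apply: lb_le_inf; first by case: (limit_bounds_inf Ba).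
by move=> r [x [_ xr]]; apply: le_trans (xr 0%N).
Qed.

Lemma sigma_part_superadd a b r : B a -> B b -> a `&` b = set0 ->
  limit_bounds (a `|` b) r -> sigma_part a + sigma_part b <= r.
Proof.
move=> Ba Bb ab [x [xab xr]]; have [_ xmono _] := xab.
have xa : increases_to B (fun n => x n `&` a) a.
  by have := increases_toI BA Ba xab; rewrite setUK.
have xb : increases_to B (fun n => x n `&` b) b.
  by have := increases_toI BA Bb xab; rewrite setUC setUK.
have split_le j k : mu (x j `&` a) + mu (x k `&` b) <= r.
  rewrite -muU; last by rewrite setIACA ab setI0.
  apply: le_trans (xr (maxn j k)); apply: mu_le => z [[xz _]|[xz _]].
    by apply: xmono xz; exact: leq_maxl.
  by apply: xmono xz; exact: leq_maxr.
rewrite -lerBrDr; apply: sigma_part_le => //; exists (fun n => x n `&` a); split=> // j.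
rewrite lerBrDr -lerBrDl; apply: sigma_part_le => //.
exists (fun n => x n `&` b); split=> // k.
by rewrite lerBrDl.
Qed.

Lemma sigma_partU a b : B a -> B b -> a `&` b = set0 ->
  sigma_part (a `|` b) = sigma_part a + sigma_part b.
Proof.
move=> Ba Bb ab; apply/eqP; rewrite eq_le; apply/andP; split; last first.
  apply: lb_le_inf; first by case: (limit_bounds_inf (baU BA Ba Bb)).
  by move=> r; apply: sigma_part_superadd.
apply/ler_addgt0Pr => e e0; have e2 : 0 < e / 2 by lra.
have [r [x [xa xr]] rlt] := sigma_part_near Ba e2.
have [q [y [yb yq]] qlt] := sigma_part_near Bb e2.
apply: le_trans (_ : r + q <= _); last by lra.
apply: sigma_part_le; first exact: baU.
exists (fun n => x n `|` y n); split; first exact: increases_toU.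
by move=> k; apply: le_trans (mu_subadd _ _) _; apply: lerD.
Qed.

(** If the value at [a] is 0, there are sequences increasing to [a] along which
    [mu] is at most [2 ^- n].  A diagonal sequence converges to [a], so almost all
    of its terms contain a common nonzero part of [a], on which [mu] is 0. *)
Lemma sigma_part_gt0 a : B a -> a <> set0 -> 0 < sigma_part a.
Proof.
move=> Ba a_neq0; rewrite lt_neqAle sigma_part_ge0 // andbT; apply/eqP => a0.
have /choice[x xP] : forall n, exists x, increases_to B x a /\ forall k, mu (x k) <= 2^-1 ^+ n.
  move=> n; have [|r [x [xa xr]] rlt] := @sigma_part_near a (2^-1 ^+ n) Ba.
    by rewrite exprn_gt0.
  by exists x; split=> // k; apply: le_trans (xr k) (ltW _); rewrite -a0 add0r in rlt.
have [k [s [Bs smono ks s0]]] := diagonal_vanishing BS WD (fun n => (xP n).1).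
apply: a_neq0; apply: s0 => // n; rewrite -setD_eq0; apply: contrapT => d0.
have := mu_gt0 (baD BA Ba (Bs n)) d0; apply/negP; rewrite -leNgt.
have small m : (n <= m)%N -> mu (a `\` s n) <= 2^-1 ^+ m.
  move=> nm; apply: le_trans ((xP m).2 (k m)); apply: mu_le => z [az nsz].
  by apply: contrapT => nxz; apply: nsz; apply: smono nm _ _; apply: ks.
have half_cvg : (fun m => (2^-1 : R) ^+ m) @ \oo --> 0.
  by apply: cvg_expr; rewrite ger0_norm ?invf_lt1 ?ltr1n.
have -> : 0 = lim ((fun m => (2^-1 : R) ^+ m) @ \oo) by apply/esym/cvg_lim.
apply: limr_ge; first by apply/cvg_ex; exists 0.
by near=> m; apply: small; near: m; exists n.
Unshelve. all: by end_near.
Qed.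

Lemma sigma_part_mono a b : B a -> B b -> a `<=` b -> sigma_part a <= sigma_part b.
Proof.
move=> Ba Bb ab; rewrite -(setDUK ab) sigma_partU ?lerDl ?sigma_part_ge0 //; try exact: baD.
by rewrite setIDA setIC -setIDA setDv setI0.
Qed.

(** One inequality is monotonicity.  For the other, choose for each [n] a sequence
    increasing to [a n] with an error of at most [e * 2 ^- n.+1]; the unions of
    the first [k] of these sequences at index [k] increase to [s]. *)
Lemma sigma_part_sigma (a : nat -> set S) s : (forall n, B (a n)) ->
  (forall i j, i <> j -> a i `&` a j = set0) -> is_sup B (range a) s ->
  series (fun n => sigma_part (a n)) @ \oo --> sigma_part s.
Proof.
move=> Ba disj [Bs sub min_s].
have seriesE N : series (fun n => sigma_part (a n)) N = \sum_(n < N) sigma_part (a n).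
  by rewrite /series /= big_mkord.
have le_s N : series (fun n => sigma_part (a n)) N <= sigma_part s.
  rewrite seriesE; have [BN <-] := additive_bigU BA sigma_partU N Ba disj.
  apply: sigma_part_mono => //; rewrite -bigcup_mkord => z [n _ az].
  by apply: sub az; exists n.
have mono : nondecreasing_seq (series (fun n => sigma_part (a n))).
  by apply: nondecreasing_series => n _ _; apply: sigma_part_ge0.
have cv : cvgn (series (fun n => sigma_part (a n))).
  by apply: nondecreasing_is_cvgn => //; exists (sigma_part s) => _ [N _ <-].
suff -> : sigma_part s = limn (series (fun n => sigma_part (a n))) by [].
apply/eqP; rewrite eq_le; apply/andP; split; last first.
  by apply: limr_le => //; near=> N; apply: le_s.
apply/ler_addgt0Pr => e e0.
have /choice[x xP] : forall n, exists x, increases_to B x (a n) /\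
    forall k, mu (x k) <= sigma_part (a n) + e * 2^-1 ^+ n.+1.
  move=> n; have [|r [x [xa xr]] rlt] := @sigma_part_near (a n) (e * 2^-1 ^+ n.+1) (Ba n).
    by rewrite mulr_gt0 ?exprn_gt0.
  by exists x; split=> // k; apply: le_trans (xr k) (ltW rlt).
apply: sigma_part_le => //.
exists (fun k => \big[setU/set0]_(n < k.+1) x n k); split; last first.
  move=> k; apply: le_trans (mu_bigU (fun n => x n k) _) _.
  apply: le_trans (_ : \sum_(n < k.+1) (sigma_part (a n) + e * 2^-1 ^+ n.+1) <= _).
    by apply: ler_sum => n _; apply: (xP n).2.
  rewrite big_split /=; apply: lerD.
    by rewrite -seriesE; apply: nondecreasing_cvgn_le.
  by rewrite -mulr_sumr ler_piMr ?sum_half_le1 // ltW.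
have Bx n k : B (x n k) by case: (xP n) => -[].
split=> [k|k m km|].
- by apply: big_ind; [exact: ba0|exact: baU|].
- rewrite -!(bigcup_mkord _ (fun n => x n _)) => z [n /= nk xz].
  exists n => /=; first exact: leq_trans nk _.
  by case: (xP n) => -[_ xmono _] _; apply: xmono xz.
- split=> // [_ [k _ <-]|t Bt xt].
    rewrite -(bigcup_mkord _ (fun n => x n k)) => z [n _ xz].
    apply: (sub (a n)); first by exists n.
    by apply: increases_to_sub (xP n).1 _ xz.
  apply: min_s => // _ [n _ <-]; apply: increases_to_min (xP n).1 Bt _ => k z xz.
  apply: (xt (\big[setU/set0]_(i < (maxn n k).+1) x i (maxn n k))); first by exists (maxn n k).
  rewrite -(bigcup_mkord _ (fun i => x i (maxn n k))); exists n => /=.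
    by rewrite ltnS leq_maxl.
  by case: (xP n) => -[_ xmono _] _; apply: xmono xz; exact: leq_maxr.
Unshelve. all: by end_near.
Qed.

Lemma sigma_part_is_measure : [set: S] !=set0 ->
  is_measure B (fun a => sigma_part a / sigma_part setT).
Proof.
move=> [x0 _]; have T0 : 0 < sigma_part setT.
  by apply: sigma_part_gt0; [exact: baT|move=> T0; have : setT x0 by []; rewrite T0].
split.
- by rewrite (additive0 BA sigma_partU) mul0r.
- by move=> a Ba a0; rewrite divr_gt0 // sigma_part_gt0.
- by rewrite divff // gt_eqF.
- by move=> a b Ba Bb ab; rewrite ler_pM2r ?invr_gt0 // sigma_part_mono.
- by move=> a b Ba Bb ab; rewrite sigma_partU // mulrDl.
- move=> a s Ba disj sup_s.
  have -> : series (fun n => sigma_part (a n) / sigma_part setT) =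
      (fun N => series (fun n => sigma_part (a n)) N / sigma_part setT).
    by apply/funext => N; rewrite /series /= mulr_suml.
  by apply: cvgM; [apply: sigma_part_sigma|apply: cvg_cst].
Qed.
End Regularization.

(** * Measure algebras *)

Section MeasureAlgebra.
Variables (R : realType) (S : Type) (B : set (set S)).
Hypothesis BS : boolean_sigma_algebra B.
Let BA : boolean_algebra B := BS.1.
Variable m : set S -> R.
Hypothesis mP : is_measure B m.

Lemma measure_nneg a : B a -> 0 <= m a.
Proof.
move=> Ba; rewrite -(measure_zero mP).
exact: measure_mono mP _ _ (ba0 BA) Ba (@sub0set _ a).
Qed.

(** Countable subadditivity, from additivity along the differences
    [seqDU b]. *)
Lemma measure_sup_le (b : nat -> set S) s r : (forall n, B (b n)) ->
  is_sup B (range b) s -> (forall N, \sum_(n < N) m (b n) <= r) -> m s <= r.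
Proof.
move=> Bb [Bs bs min_s] br.
have Bd n : B (seqDU b n).
  by apply: baD => //; apply: big_ind; [exact: ba0|exact: baU|].
have sup_d : is_sup B (range (seqDU b)) s.
  split=> // [_ [n _ <-]|t Bt dt].
    by apply: subset_trans (@subDsetl _ _ _) _; apply: bs; exists n.
  apply: min_s => // _ [n _ <-] z bz.
  have : (\bigcup_k b k) z by exists n.
  rewrite seqDU_bigcup_eq => -[k _]; apply: dt; by exists k.
have disj i j : i <> j -> seqDU b i `&` seqDU b j = set0.
  move=> ij; apply: contrapT => /eqP/set0P; move: (trivIset_seqDU b) => /(_ i j I I) h /h.
  exact: ij.
have cv := measure_sigma_add mP Bd disj sup_d.
rewrite -(cvg_lim _ cv) //; apply: limr_le; first by apply/cvg_ex; exists (m s).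
near=> N; rewrite /series /= big_mkord; apply: le_trans (br N); apply: ler_sum => n _.
by apply: (measure_mono mP) => //; apply: subDsetl.
Unshelve. all: by end_near.
Qed.

(** The supremum of the [n]-th tail has measure at most [2 * 2 ^- n]. *)
Lemma borel_cantelli (a : nat -> set S) : (forall n, B (a n)) ->
  (forall n, m (a n) <= 2^-1 ^+ n) -> vanishing B a.
Proof.
move=> Ba am; have [u usup] := tail_sup BS Ba.
have um n : m (u n) <= 2^-1 ^+ n * 2.
  apply: (@measure_sup_le (fun k => a (n + k)%N)) => // [|N].
    have [Bu ub ul] := usup n; split=> // [_ [k _ <-]|t Bt at_].
      by apply: ub; exists (n + k)%N => //=; exact: leq_addr.
    apply: ul => // _ [k /= nk <-]; rewrite -(subnKC nk).
    by apply: at_; exists (k - n)%N.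
  apply: le_trans (_ : \sum_(k < N) (2^-1 ^+ n * 2) * 2^-1 ^+ k.+1 <= _).
    by apply: ler_sum => k _; apply: le_trans (am _) _; rewrite exprD exprS; lra.
  by rewrite -mulr_sumr ler_piMr ?sum_half_le1 // mulr_ge0 ?exprn_ge0.
apply: (vanishing_of_tail_sup usup) => d Bd du.
apply: contrapT => d0; have := measure_pos mP Bd d0.
apply/negP; rewrite -leNgt.
have half_cvg : (fun n => (2^-1 : R) ^+ n * 2) @ \oo --> 0.
  rewrite -[X in _ --> X](mul0r 2); apply: cvgM; last exact: cvg_cst.
  by apply: cvg_expr; rewrite ger0_norm ?invf_lt1 ?ltr1n.
rewrite -(cvg_lim _ half_cvg) //; apply: limr_ge; first by apply/cvg_ex; exists 0.
near=> n; apply: le_trans (um n); apply: (measure_mono mP) => //.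
by case: (usup n).
Unshelve. all: by end_near.
Qed.

Lemma measureC a : B a -> m (~` a) = 1 - m a.
Proof.
move=> Ba; rewrite -(measure_one mP) -(setUv a).
by rewrite (Defs.measure_add mP) ?setICr //; [lra|exact: baC].
Qed.

(** The partition is enumerated as a sequence [w], padded with [set0]; a long
    enough partial sum of the measures is close to 1. *)
Lemma finite_part W e : countable W -> maximal_antichain B W -> 0 < e ->
  exists E, [/\ finite_set E, E `<=` W, B (\bigcup_(c in E) c) &
    m (~` \bigcup_(c in E) c) <= e].
Proof.
move=> /countable_injP[idx idx_inj] [[WB W0 Wdisj] [_ _ Wsup]] e0.
have /choice[w wP] : forall k, exists c, (W c /\ idx c = k) \/
    (c = set0 /\ forall c', W c' -> idx c' <> k).
  move=> k; have [[c cP]|none] := pselect (exists c, W c /\ idx c = k).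
    by exists c; left.
  by exists set0; right; split=> // c Wc ck; apply: none; exists c.
have w_idx c : W c -> w (idx c) = c.
  move=> Wc; case: (wP (idx c)) => [[Ww /idx_inj]|[_ /(_ c Wc)//]].
  by apply; exact: mem_set.
have Bw k : B (w k) by case: (wP k) => [[/WB]|[-> _]] //; exact: ba0.
have disj i j : i <> j -> w i `&` w j = set0.
  move=> ij; case: (wP i) => [[Wi ei]|[-> _]]; last by rewrite set0I.
  case: (wP j) => [[Wj ej]|[-> _]]; last by rewrite setI0.
  by apply: Wdisj => // eq_w; apply: ij; rewrite -ei -ej eq_w.
have sup_w : is_sup B (range w) setT.
  split=> // [|t Bt wt]; first exact: baT.
  by apply: Wsup => // c Wc; rewrite -(w_idx c Wc); apply: wt; exists (idx c).
have := measure_sigma_add mP Bw disj sup_w; rewrite (measure_one mP).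
move=> /cvgrPdist_le/(_ _ e0)[N _ /(_ N (leqnn N))]; rewrite /series /= big_mkord.
have [BN <-] := additive_bigU BA (Defs.measure_add mP) N Bw disj => Ne.
exists [set c | W c /\ exists2 k, (k < N)%N & w k = c].
set E := (X in finite_set X).
have EN : \bigcup_(c in E) c = \big[setU/set0]_(n < N) w n.
  rewrite -bigcup_mkord; apply/seteqP; split=> z [].
    by move=> c [_ [k kN <-]] wz; exists k.
  move=> k kN wz; exists (w k) => //; split; last by exists k.
  by case: (wP k) => [[]//|[wk _]]; rewrite wk in wz.
split=> //.
- by apply: sub_finite_set (finite_image w (finite_II N)) => c [_ [k kN <-]]; exists k.
- by move=> c [].
- by rewrite EN.
- by rewrite EN measureC //; apply: le_trans (ler_norm _) Ne.
Qed.

Lemma measure_weakly_distributive : weakly_distributive B.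
Proof.
move=> W WP.
have /choice[E EP] : forall n, exists E, [/\ finite_set E, E `<=` W n, B (\bigcup_(c in E) c) &
    m (~` \bigcup_(c in E) c) <= 2^-1 ^+ n].
  by move=> n; case: (WP n) => cW aW; apply: finite_part => //; rewrite exprn_gt0.
exists E; split=> [n|]; first by case: (EP n).
apply: (limT_of_vanishing BS) => [n|]; first by case: (EP n).
by apply: borel_cantelli => n; case: (EP n) => // _ _ ? _; apply: baC.
Qed.

Lemma seq_min_exists (s : seq (set S)) : s != [::] ->
  exists2 c, c \in s & forall d, d \in s -> m c <= m d.
Proof.
case: s => // c s _; elim: s c => [|b s IH] c.
  by exists c => [|d]; rewrite ?mem_seq1 // => /eqP ->.
have [d ds dmin] := IH b; have [cd|dc] := leP (m c) (m d).
  exists c => [|x]; rewrite ?mem_head // inE => /orP[/eqP ->//|/dmin].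
  exact: le_trans.
exists d => [|x]; first by rewrite inE ds orbT.
by rewrite inE => /orP[/eqP ->|/dmin//]; apply: ltW.
Qed.

(** [F] picks an element of least measure; among [M] disjoint elements it has
    measure at most [M^-1]. *)
Lemma measure_uniformly_concentrated : uniformly_concentrated B.
Proof.
have /choice[F FP] : forall A : set (set S), exists c,
    finite_set A -> A !=set0 -> A c /\ forall d, A d -> m c <= m d.
  move=> A; have [/finite_seqP[s ->]|] := pselect (finite_set A); last by exists set0.
  have [->|s0] := eqVneq s [::]; first by exists set0 => _ [].
  by have [c cs cmin] := seq_min_exists s0; exists c.
exists F; split=> [A _ fA A0|A AP]; first by case: (FP A fA A0).
have A_n0 n : A n !=set0.
  have [_ _ /pcard_leP[g]] := AP n; exists (g 0%N).
  have gS := @funS _ _ _ _ g; apply: gS; by rewrite /= expn_gt0.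
have FA n : A n (F (A n)) by case: (AP n) => _ fA _; case: (FP _ fA (A_n0 n)).
have BF n : B (F (A n)) by case: (AP n) => -[AB _ _] _ _; apply: AB.
apply: (lim0_of_vanishing BS) => //; apply: borel_cantelli => // n.
have [[AB _ Adisj] fA /pcard_leP[g]] := AP n.
set M := (2 ^ n.+1)%N in g.
pose h k := if (k < M)%N then g k else set0.
have gA k : (k < M)%N -> A n (g k) by move=> kM; have gS := @funS _ _ _ _ g; apply: gS.
have Bh k : B (h k).
  by rewrite /h; case: ifP => [/gA/AB//|_]; exact: ba0.
have disj i j : i <> j -> h i `&` h j = set0.
  rewrite /h => ij; case: ifP => iM; last by rewrite set0I.
  case: ifP => jM; last by rewrite setI0.
  apply: Adisj; [exact: gA|exact: gA|] => gij; apply: ij.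
  by have gI := @inj _ _ _ g; apply: gI => //; rewrite inE.
have [BM hM] := additive_bigU BA (Defs.measure_add mP) M Bh disj.
have : M%:R * m (F (A n)) <= 1.
  rewrite -[leRHS](measure_one mP).
  apply: le_trans (_ : m (\big[setU/set0]_(k < M) h k) <= _); last first.
    by apply: (measure_mono mP) => //; exact: baT.
  rewrite hM mulr_natl -[M in _ *+ M]card_ord -sumr_const; apply: ler_sum => k _.
  by rewrite /h ltn_ord; apply: (FP _ fA (A_n0 n)).2; apply: gA.
rewrite mulrC -ler_pdivlMr ?ltr0n ?expn_gt0 // div1r natrX -exprVn => h1.
apply: le_trans h1 _; rewrite exprS; have : 0 <= (2^-1 : R) ^+ n by rewrite exprn_ge0.
lra.
Qed.

End MeasureAlgebra.

(** * The characterization *)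

Theorem theorem0p1 (R : realType) (S : Type) (B : set (set S)) :
  [set: S] !=set0 ->
  boolean_sigma_algebra B ->
  measure_algebra R B <-> weakly_distributive B /\ uniformly_concentrated B.
Proof.
move=> S0 BS; split=> [[_ [m mP]]|[WD [F [F_in F_lim]]]].
  by split; [apply: measure_weakly_distributive mP|apply: measure_uniformly_concentrated mP].
have [mu [mu_ge0 _ muU mu_gt0]] := fragmentation_measure BS WD F_in F_lim R S0.
split=> //; exists (fun a => sigma_part B mu a / sigma_part B mu setT).
exact: sigma_part_is_measure.
Qed.
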